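(* Let $m\ge 1$ and let $A\in M_m(\mathbb{Z})$ be any dilation matrix all of whose eigenvalues are rational. Then there exists a digit set $D_A$ for $A$ such that $T(A,D_A)$ is connected.
   Context: A dilation matrix is a matrix $A\in M_m(\mathbb{Z})$ all of whose eigenvalues $\lambda$ satisfy $|\lambda|>1$. A digit set (also called a basic digit set) for $A$ is a complete set $D\subset\mathbb{Z}^m$ of coset representatives of $\mathbb{Z}^m/A(\mathbb{Z}^m)$, with exactly one representative from each coset. For a dilation matrix $A$ and a finite set $D$, $T(A,D)$ denotes the attractor of the iterated function system $\{f_d : d\in D\}$, $f_d(x)=A^{-1}(x+d)$ for $x\in\mathbb{R}^m$; equivalently $T(A,D)=\{\sum_{j=1}^{\infty}A^{-j}d_j : d_j\in D\}$. *)

(* Defs.v *)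
From HB Require Import structures.
From mathcomp Require Import all_boot all_order all_algebra.
From mathcomp Require Import finmap.
From mathcomp Require Import all_classical all_reals all_analysis.
From mathcomp Require Export complex.

Set Implicit Arguments.
Unset Strict Implicit.
Unset Printing Implicit Defensive.

Import Order.TTheory GRing.Theory Num.Theory.
Export numFieldNormedType.Exports.

Local Open Scope classical_set_scope.
Local Open Scope ring_scope.

(* MathComp's [eigenvalue] is phrased with row vectors (left eigenvectors);
   for a square matrix over a field these are the usual eigenvalues. *)
Definition complex_eigenvalue (R : realType) (m : nat) (A : 'M[int]_m)
    (lambda : R[i]) : Prop :=
  eigenvalue (map_mx intr A : 'M[R[i]]_m) lambda.

Definition is_dilation (R : realType) (m : nat) (A : 'M[int]_m) : Prop :=
  forall lambda : R[i], complex_eigenvalue A lambda -> 1 < `|lambda|.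

Definition rational_spectrum (R : realType) (m : nat) (A : 'M[int]_m) : Prop :=
  forall lambda : R[i], complex_eigenvalue A lambda ->
    exists q : rat, lambda = ratr q.

Definition is_digit_set (m : nat) (A : 'M[int]_m)
    (D : {fset 'cV[int]_m}) : Prop :=
  forall z : 'cV[int]_m,
    exists! d : 'cV[int]_m,
      d \in D /\ exists w : 'cV[int]_m, z - d = A *m w.

Definition ifs_map (R : realType) (m : nat) (A : 'M[int]_m) (d : 'cV[int]_m)
    (x : 'cV[R]_m) : 'cV[R]_m :=
  invmx (map_mx intr A) *m (x + map_mx intr d).

(* [T] is T(A, D): for a dilation matrix [A] some power of x |-> A^-1 x is a
   contraction, so exactly one nonempty compact [T] satisfies this when [D] is
   nonempty. *)
Definition is_attractor (R : realType) (m : nat) (A : 'M[int]_m)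
    (D : {fset 'cV[int]_m}) (T : set 'cV[R]_m) : Prop :=
  [/\ T !=set0, compact T & T = \bigcup_(d in [set` D]) (ifs_map A d @` T)].

(* Main.v *)
Require Import Defs.
From HB Require Import structures.
From mathcomp Require Import all_boot all_order all_algebra.
From mathcomp Require Import finmap.
From mathcomp Require Import all_classical all_reals all_analysis.
From mathcomp Require Import algC algnum.
From mathcomp Require Import ring lra zify.

(** The rational eigenvalues of A are integers, and splitting off one integral
    eigenvector at a time gives a unimodular P with P A = L P, where L is lower
    triangular over the integers and |L_ii| >= 2
    ([integral_triangularization]).  It is therefore enough to find digits for
    L.  They are the vectors (e_i n_i) with 0 <= n_i < |L_ii|, where the
    positive integers e_i have two properties ([scaling_exists]):

    - e_i = 1 modulo L_ii, so that these vectors represent each coset of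
      L Z^m exactly once, by solving one row after the other
      ([trig_residue_exists], [trig_residue_unique]);
    - e_i grows so fast with i that 2 * sum_(j < i) |L_ij| e_j <= e_i.

    In the coordinates rescaled by the e_i the digits become the box
    0 <= n_i < |L_ii|, and L becomes a real matrix M with the same diagonal and
    with off-diagonal part of row sums at most 1/2.  Then M^-1 contracts the sup
    norm by 2/3, and the attractor behaves like that of a diagonal matrix, which
    is a product of intervals of length 1.

    An attractor T is connected as soon as its pieces f_d(T) form a connected
    graph under the relation of meeting ([attractor_connected]).  The digits of
    a box are joined by steps along the coordinate vectors, and f_d(T) meets
    f_d'(T) for d - d' = x exactly when x belongs to T - T.  So it remains to
    see that each coordinate vector lies in T - T, the attractor of M for the
    differences of digits: one must keep its orbit under x |-> M x - (u - v)
    bounded with suitable digits u and v ([difference_in_attractor]).  The orbit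
    of the i-th coordinate vector can be kept inside the set of vectors with
    zero entries above i, entry 1 or -1 at i, and entries at most 1/2 in
    absolute value below i ([unit_step_orbit]). *)

Set Implicit Arguments.
Unset Strict Implicit.
Unset Printing Implicit Defensive.

Import Order.TTheory GRing.Theory Num.Theory.

Local Open Scope classical_set_scope.
Local Open Scope ring_scope.

(** * Integral triangularization *)

(** Such a rational number is an algebraic integer. *)
Lemma rational_root_monic_int (F : numFieldType) (p : {poly int}) (q : rat) :
  p \is monic -> root (map_poly (intr : int -> F) p) (ratr q) ->
  exists n : int, q = n%:~R.
Proof.
move=> pm pq.
have intrE (K : numFieldType) : map_poly (intr : int -> K) p
    = map_poly ratr (map_poly (intr : int -> rat) p).
  by rewrite -map_poly_comp; apply: eq_map_poly => n /=; rewrite ratr_int.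
have pQ : root (map_poly (intr : int -> rat) p) q.
  by move: pq; rewrite intrE fmorph_root.
have : (ratr q : algC) \in Num.int.
  apply: Cint_rat_Aint; first exact: Crat_rat.
  apply: (@root_monic_Aint (map_poly intr p)); first by rewrite intrE fmorph_root.
    exact: monic_map.
  by apply/polyOverP => i; rewrite coef_map /= intr_int.
by rewrite Cint_rat => /intrP [n ->]; exists n.
Qed.

Lemma int_eigenvector (n : nat) (A : 'M[int]_n) (a : int) :
  \det (a%:M - A) = 0 -> exists2 v : 'rV[int]_n, v != 0 & v *m A = a *: v.
Proof.
move=> /eqP /det0P [v v0 vA]; exists v => //.
by move: vA => /eqP; rewrite mulmxBr mul_mx_scalar subr_eq0 => /eqP.
Qed.

(** The Smith normal form of a single row is (d, 0, ..., 0), so its right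
    transformation matrix starts with a multiple of that row.  This is the
    extension of a primitive vector to a basis of the lattice. *)
Lemma unimodular_first_row (n : nat) (v : 'rV[int]_(1 + n)) : v != 0 ->
  exists2 U : 'M[int]_(1 + n), U \in unitmx &
  exists2 c : int, c != 0 & v = c *: usubmx U.
Proof.
move=> v0; have [L _ [U Uu [d _ vE]]] := int_Smith_normal_form v.
exists U => //; exists (L 0 0 * d`_0).
  apply: contra_neq v0 => c0; rewrite vE [L]mx11_scalar mul_scalar_mx.
  apply/rowP => j; rewrite !mxE big1 // => k _; rewrite !mxE.
  case: eqP => _; last by rewrite mulr0n mulr0 mul0r.
  by rewrite mulr1n c0 mul0r.
rewrite {1}vE [L]mx11_scalar mul_scalar_mx -scalerA -!scalemxAl; congr (_ *: _).
  by rewrite !mxE eqxx mulr1n.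
apply/rowP => j; rewrite !mxE (bigD1 ord0) //= big1 ?addr0.
  by rewrite !mxE eqxx mulr1n; congr (_ * U _ _); apply: val_inj.
move=> k; rewrite -val_eqE eq_sym !mxE /= => /negPf ->.
by rewrite mulr0n mul0r.
Qed.

Lemma det_similar (F : comUnitRingType) (n : nat) (P A B : 'M[F]_n) (z : F) :
  P \in unitmx -> P *m A = B *m P -> \det (z%:M - A) = \det (z%:M - B).
Proof.
move=> Pu PA; have Pdu : \det P \is a GRing.unit by rewrite -unitmxE.
apply: (mulrI Pdu); rewrite -det_mulmx mulmxBr PA mul_mx_scalar -mul_scalar_mx.
by rewrite -mulmxBl det_mulmx mulrC.
Qed.

(** A basis of the lattice whose first vector is an eigenvector makes the first
    row of the matrix a multiple of the first coordinate vector. *)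
Lemma eigenvector_block (n : nat) (A : 'M[int]_(1 + n)) (a : int)
    (v : 'rV[int]_(1 + n)) : v != 0 -> v *m A = a *: v ->
  exists2 U : 'M[int]_(1 + n), U \in unitmx &
  exists c B, U *m A = block_mx a%:M 0 c B *m U.
Proof.
move=> v0 vA; have [U Uu [c c0 vE]] := unimodular_first_row v0.
have uA : usubmx U *m A = a *: usubmx U.
  apply/rowP => j; apply: (mulfI c0); move/rowP/(_ j): vA.
  by rewrite vE -scalemxAl !mxE mulrCA.
pose N := U *m A *m invmx U.
have NU : U *m A = N *m U by rewrite /N mulmxKV.
have Nu : usubmx N = row_mx a%:M 0.
  rewrite /N -!mul_usub_mx uA -scalemxAl mul_usub_mx mulmxV //.
  by rewrite (scalar_mx_block _ _ 1) block_mxEv col_mxKu scale_row_mx scaler0 scalemx1.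
exists U => //; exists (dlsubmx N), (drsubmx N).
rewrite NU -[N in LHS]vsubmxK Nu block_mxEv; congr (col_mx _ _ *m _).
by rewrite hsubmxK.
Qed.

(** Induction on the size: after an integral eigenvector has been split off, the
    characteristic polynomial of the remaining block divides that of A, so the
    hypothesis on the eigenvalues is inherited. *)
Lemma integral_triangularization (C : numClosedFieldType) (m : nat)
    (A : 'M[int]_m) :
  (forall z : C, \det (z%:M - map_mx intr A) = 0 ->
     exists2 a : int, z = a%:~R & 1 < `|a|) ->
  exists P L : 'M[int]_m,
    [/\ P \in unitmx, P *m A = L *m P, is_trig_mx L & forall i, 1 < `|L i i|].
Proof.
elim: m A => [|m IH] A hA.
  exists 1%:M, A; split; rewrite ?unitmx1 ?mul1mx ?mulmx1 //; last by case.
  by apply/is_trig_mxP => -[].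
have [z zA] : exists z : C, eigenvalue (map_mx intr A) z.
  have /closed_rootP [z rz] : size (char_poly (map_mx intr A : 'M[C]_m.+1)) != 1%N.
    by rewrite size_char_poly.
  by exists z; rewrite eigenvalue_root_char.
have [a za a1] : exists2 a : int, z = a%:~R & 1 < `|a|.
  apply: hA; apply/eqP/det0P; move/eigenvalueP: zA => [v vA v0]; exists v => //.
  by rewrite mulmxBr vA mul_mx_scalar subrr.
have [v v0 vA] : exists2 v : 'rV[int]_m.+1, v != 0 & v *m A = a *: v.
  apply: int_eigenvector; apply/eqP; rewrite -(intr_eq0 C) -det_map_mx.
  rewrite map_mxB map_scalar_mx /= -za.
  move/eigenvalueP: zA => [w wA w0]; apply/det0P; exists w => //.
  by rewrite mulmxBr wA mul_mx_scalar subrr.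
have [U Uu [c [B UA]]] := @eigenvector_block m A a v v0 vA.
have [|P [L [Pu PB Lt Ld]]] := IH B.
  move=> w hw; apply: hA.
  rewrite (@det_similar _ _ (map_mx intr U) _ (map_mx intr (block_mx a%:M 0 c B))).
  - rewrite map_block_mx map_mx0 (scalar_mx_block _ _ w) -[- block_mx _ _ _ _]/(-%R _).
    rewrite opp_block_mx add_block_mx subr0.
    by rewrite det_lblock hw mulr0.
  - by rewrite unitmxE det_map_mx rmorph_unit -?unitmxE.
  - by rewrite -!map_mxM UA.
have P1u : (block_mx 1%:M 0 0 P : 'M[int]_(1 + m)) \in unitmx.
  by rewrite unitmxE det_lblock det1 mul1r -unitmxE.
have P1B : (block_mx 1%:M 0 0 P : 'M[int]_(1 + m)) *m block_mx a%:M 0 c B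
    = block_mx a%:M 0 (P *m c) L *m block_mx 1%:M 0 0 P.
  by rewrite !mulmx_block !(mul0mx, mulmx0, mul1mx, mulmx1, addr0, add0r) PB.
have L1t : is_trig_mx (block_mx a%:M 0 (P *m c) L : 'M[int]_(1 + m)).
  by rewrite is_trig_block_mx // eqxx mx11_is_trig.
have L1d (i : 'I_(1 + m)) : 1 < `|block_mx a%:M 0 (P *m c) L i i|.
  case: (split_ordP i) => j ->; last by rewrite block_mxEdr.
  by rewrite block_mxEul [j]ord1 mxE eqxx.
exists (block_mx 1%:M 0 0 P *m U), (block_mx a%:M 0 (P *m c) L); split.
- by rewrite unitmx_mul Uu andbT.
- by rewrite -mulmxA UA !mulmxA P1B.
- exact: L1t.
- exact: L1d.
Qed.

Lemma rational_dilation_triangularization (R : realType) (m : nat) (A : 'M[int]_m) :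
  is_dilation R A -> rational_spectrum R A ->
  exists P L : 'M[int]_m,
    [/\ P \in unitmx, P *m A = L *m P, is_trig_mx L & forall i, 1 < `|L i i|].
Proof.
move=> hA hq; apply: (@integral_triangularization R[i]) => z /eqP/det0P [v v0 vA].
have zA : complex_eigenvalue A z.
  apply/eigenvalueP; exists v => //; apply/eqP; rewrite -mul_mx_scalar.
  by rewrite eq_sym -subr_eq0 -mulmxBr vA.
have [q zq] := hq z zA.
have [n qn] : exists n : int, q = n%:~R.
  apply: (@rational_root_monic_int R[i] (char_poly A)); first exact: char_poly_monic.
  by rewrite map_char_poly -eigenvalue_root_char -zq.
exists n; first by rewrite zq qn ratr_int.
by have := hA z zA; rewrite zq qn ratr_int -intr_norm ltr1z.
Qed.

(** * Digit sets of triangular matrices *)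

Definition digit_box (m : nat) (L : 'M[int]_m) (n : 'cV[int]_m) : Prop :=
  forall i, 0 <= n i 0 < `|L i i|.

Lemma digit_box_finite (m : nat) (L : 'M[int]_m) (f : 'cV[int]_m -> 'cV[int]_m) :
  exists D : {fset 'cV[int]_m},
    forall d, d \in D <-> exists2 n, digit_box L n & d = f n.
Proof.
pose F := {dffun forall i : 'I_m, 'I_(`|L i i|%N)}.
pose num (h : F) : 'cV[int]_m := \col_i Posz (h i).
exists [fset f (num h) | h : F]%fset => d; split.
  move=> /imfsetP [h _ ->]; exists (num h) => // i.
  by rewrite mxE /= -abszE ltz_nat ltn_ord.
move=> [n hn ->]; apply/imfsetP.
have lt_n i : (`|n i 0%R| < `|L i i|)%N by have := hn i; lia.
exists ([ffun i => Ordinal (lt_n i)] : F) => //.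
congr f; apply/colP => i; rewrite mxE ffunE /=.
by have := hn i; lia.
Qed.

(** In row i the entries of w found so far leave a residue r, to be written as
    e_i n_i + L_ii w_i.  As e_i = 1 modulo L_ii, the remainder of r modulo L_ii
    serves as n_i. *)
Lemma trig_residue_exists (m : nat) (L : 'M[int]_m) (e : 'rV[int]_m) :
  is_trig_mx L -> (forall i, L i i != 0) ->
  (forall i, (L i i %| e 0%R i - 1)%Z) ->
  forall z, exists n w, digit_box L n /\ z - diag_mx e *m n = L *m w.
Proof.
move=> /is_trig_mxP Lt L0 eL z.
suff H k : (k <= m)%N -> exists n (w : 'cV[int]_m), digit_box L n /\
    forall i : 'I_m, (i < k)%N -> (z - diag_mx e *m n) i 0 = (L *m w) i 0.
  have [n [w [hn hw]]] := H m (leqnn m).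
  by exists n, w; split=> //; apply/colP => i; exact: hw.
elim: k => [_|k IH km].
  by exists 0, 0; split=> // i; rewrite mxE lexx normr_gt0 L0.
have [n [w [hn hw]]] := IH (ltnW km).
pose i0 := Ordinal km.
pose r := z i0 0 - (L *m w) i0 0.
pose a := (r %% L i0 i0)%Z.
have [t ht] : exists t, r - e 0 i0 * a = t * L i0 i0.
  apply/dvdzP; rewrite (_ : r - _ = (r - a) - (e 0 i0 - 1) * a); last by ring.
  apply: rpredB; last by rewrite dvdz_mulr.
  by rewrite {1}(divz_eq r (L i0 i0)) addrK dvdz_mull.
exists (\col_i if i == i0 then a else n i 0), (w + t *: delta_mx i0 0); split.
  move=> i; rewrite mxE; case: eqP => [->|_]; last exact: hn.
  by rewrite modz_ge0 ?ltz_mod.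
move=> i; rewrite ltnS leq_eqVlt => /orP [/eqP ik|ik].
  have -> : i = i0 by exact: val_inj.
  rewrite mulmxDr -scalemxAr -colE mul_diag_mx !mxE eqxx -ht /r /= !mxE; ring.
rewrite mulmxDr -scalemxAr -colE.
have ii0 : (i == i0) = false by rewrite -val_eqE /= ltn_eqF.
have := hw i ik; rewrite !mul_diag_mx !mxE ii0 => ->.
by rewrite [L i i0]Lt // mulr0 addr0.
Qed.

(** Once w vanishes before row i, that row reads e_i (n_i - n'_i) = L_ii w_i, so
    that L_ii divides n_i - n'_i, which is smaller than L_ii in absolute value. *)
Lemma trig_residue_unique (m : nat) (L : 'M[int]_m) (e : 'rV[int]_m) :
  is_trig_mx L -> (forall i, L i i != 0) ->
  (forall i, (L i i %| e 0%R i - 1)%Z) ->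
  forall n n' w, digit_box L n -> digit_box L n' ->
    diag_mx e *m n - diag_mx e *m n' = L *m w -> n = n'.
Proof.
move=> /is_trig_mxP Lt L0 eL n n' w hn hn' nw.
suff H k : forall i : 'I_m, (i < k)%N -> n i 0 = n' i 0 /\ w i 0 = 0.
  by apply/colP => i; exact: (H m i (ltn_ord i)).1.
elim: k => // k IH i; rewrite ltnS => ik.
have /matrixP /(_ i 0) := nw; rewrite !mul_diag_mx !mxE (bigD1 i) //=.
rewrite big1 ?addr0; last first.
  move=> j ji; have [lt_ij|le_ji] := ltnP i j; first by rewrite Lt ?mul0r.
  have lt_ji : (j < i)%N by rewrite ltn_neqAle val_eqE ji le_ji.
  by rewrite (IH j (leq_trans lt_ji ik)).2 mulr0.
rewrite -mulrBr => eq_i.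
have dvd : (L i i %| n i 0%R - n' i 0%R)%Z.
  have -> : n i 0 - n' i 0
      = e 0 i * (n i 0 - n' i 0) - (e 0 i - 1) * (n i 0 - n' i 0) by ring.
  by rewrite eq_i rpredB // ?dvdz_mulr.
have nn' : n i 0 = n' i 0.
  move/dvdzP: dvd => [q hq]; have := hn i; have := hn' i.
  have [q0|q0] := eqVneq q 0; first by move: hq; rewrite q0 mul0r; lia.
  have : `|L i i| <= `|n i 0 - n' i 0|.
    by rewrite hq normrM ler_peMl // -gtz0_ge1 normr_gt0.
  lia.
split=> //; move: eq_i; rewrite nn' subrr mulr0 => /esym /eqP.
by rewrite mulf_eq0 (negPf (L0 i)) => /eqP.
Qed.

(** The powers of one large integer K serve as the e_i; K is chosen to be 1 modulo
    every diagonal entry. *)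
Lemma scaling_exists (m : nat) (L : 'M[int]_m) : (forall i, L i i != 0) ->
  exists e : 'rV[int]_m, [/\ forall i, 0 < e 0 i,
    forall i, (L i i %| e 0%R i - 1)%Z &
    forall i : 'I_m, 2 * \sum_(j < m | (j < i)%N) `|L i j| * e 0 j <= e 0 i].
Proof.
move=> L0.
pose s := \sum_i \sum_j `|L i j|.
pose q := \prod_i `|L i i|.
pose K := 1 + q * (2 * s).
have s0 : 0 <= s by apply: sumr_ge0 => i _; apply: sumr_ge0.
have q1 : 1 <= q.
  by rewrite -gtz0_ge1; apply: prodr_gt0 => i _; rewrite normr_gt0.
have Ks : 2 * s <= K by rewrite /K; nia.
have K0 : 0 < K by rewrite /K; nia.
exists (\row_i K ^+ i); split=> i.
- by rewrite mxE exprn_gt0.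
- rewrite mxE subrX1 dvdz_mulr // /K addrC addKr dvdz_mulr //.
  by rewrite /q (bigD1 i) //= dvdz_mulr // dvdzE absz_id.
- rewrite mxE; case: i => -[|i] im /=; first by rewrite big1 ?mulr0 ?expr0.
  rewrite exprS; apply: le_trans (_ : 2 * s * K ^+ i <= _); last first.
    by rewrite ler_wpM2r // exprn_ge0 // ltW.
  rewrite -mulrA ler_wpM2l //.
  apply: le_trans (_ : \sum_(j < m) `|L (Ordinal im) j| * K ^+ i <= _).
    rewrite [leRHS](bigID (fun j : 'I_m => (j < i.+1)%N)) /=.
    rewrite -[leLHS]addr0; apply: lerD.
      apply: ler_sum => j ji; rewrite mxE ler_wpM2l //.
      by rewrite ler_weXn2l // -gtz0_ge1.
    by apply: sumr_ge0 => j _; rewrite mulr_ge0 // exprn_ge0 // ltW.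
  rewrite -mulr_suml ler_wpM2r ?exprn_ge0 ?(ltW K0) //.
  rewrite /s [leRHS](bigD1 (Ordinal im)) //= lerDl.
  by apply: sumr_ge0 => j _; apply: sumr_ge0.
Qed.

(** The matrix P carries Z^m to itself and A to L, hence cosets of A Z^m to cosets
    of L Z^m. *)
Lemma similar_digit_set (m : nat) (A P L : 'M[int]_m) (e : 'rV[int]_m)
    (D : {fset 'cV[int]_m}) :
  P \in unitmx -> P *m A = L *m P ->
  is_trig_mx L -> (forall i, L i i != 0) ->
  (forall i, (L i i %| e 0%R i - 1)%Z) ->
  (forall d, d \in D <->
     exists2 n, digit_box L n & d = invmx P *m (diag_mx e *m n)) ->
  is_digit_set A D.
Proof.
move=> Pu PA Lt L0 eL DE z.
have [n [w [hn zn]]] := trig_residue_exists Lt L0 eL (P *m z).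
have AP : A *m invmx P = invmx P *m L.
  by apply: (can_inj (mulKmx Pu)); rewrite mulmxA PA mulmxK // mulKVmx.
exists (invmx P *m (diag_mx e *m n)); split.
  split; first by apply/DE; exists n.
  exists (invmx P *m w); rewrite [RHS]mulmxA AP -mulmxA -zn mulmxBr mulKmx //.
move=> d' [/DE [n' hn' ->] [w' zw']].
congr (_ *m (_ *m _)).
apply: (trig_residue_unique Lt L0 eL (w := P *m w' - w)) => //.
rewrite mulmxBr -zn mulmxA -PA -mulmxA -zw' mulmxBr mulKVmx //.
by rewrite opprB [RHS]addrC [RHS]addrA subrK.
Qed.

(** * Attractors of linear contractions *)

Definition hutchinson (V : zmodType) (g : V -> V) (D K : set V) : set V :=
  \bigcup_(d in D) ((fun x => g (x + d)) @` K).

Lemma hutchinsonS (V : zmodType) (g : V -> V) (D K L : set V) :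
  K `<=` L -> hutchinson g D K `<=` hutchinson g D L.
Proof.
by move=> KL y [d Dd [x Kx <-]]; exists d => //; exists x => //; apply: KL.
Qed.

Lemma bounded_linear_map_continuous (R : realType) (V W : normedModType R)
    (g : {linear V -> W}) (k : R) (hk : forall x, `|g x| <= k * `|x|) :
  continuous g.
Proof.
apply/linear_bounded_continuous.
apply/linear_boundedP; near=> r => x.
apply: le_trans (hk x) _; apply: ler_wpM2r; first exact: normr_ge0.
by near: r; apply: nbhs_pinfty_ge; rewrite num_real.
Unshelve. all: by end_near. Qed.

Lemma compact_hutchinson (R : realType) (V : normedModType R)
    (g : V -> V) (gc : continuous g) (D K : set V) :
  finite_set D -> compact K -> compact (hutchinson g D K).
Proof.
move=> Dfin Kc.
rewrite /hutchinson -bigsetU_fset_set//.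
elim/big_rec: _ => [|d X _ Xc]; first exact: compact0.
apply: compactU => //; apply: continuous_compact => //.
apply: continuous_subspaceT => x.
apply: (@continuous_comp _ _ _ (fun x => x + d) g); last exact: gc.
by apply: (@cvgD _ V _ _ _ id (cst d)); [exact: cvg_id | exact: cvg_cst].
Qed.

Lemma compact_difference_set (R : realType) (V : normedModType R) (A B : set V) :
  compact A -> compact B -> compact [set p.1 - p.2 | p in A `*` B].
Proof.
move=> Ac Bc; apply: continuous_compact; last exact: compact_setX.
by apply: continuous_subspaceT => p; apply: cvgB; [exact: cvg_fst | exact: cvg_snd].
Qed.


(** The attractor is obtained without a limit, as the largest subset T of an
    invariant ball that satisfies T <= F(T), where F is the Hutchinson operator.
    Maximality gives both F(T) <= T and, as F preserves compactness, that T is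
    closed. *)
Lemma attractor_exists (R : realType) (V : normedModType R)
    (heine_borel : forall C : R, compact [set x : V | `|x| <= C])
    (g : {linear V -> V}) (k : R) (k0 : 0 <= k) (k1 : k < 1)
    (hk : forall x, `|g x| <= k * `|x|) (D : set V) :
  finite_set D -> D 0 ->
  exists T : set V, [/\ T !=set0, compact T & T = hutchinson g D T].
Proof.
move=> Dfin D0.
have gc := bounded_linear_map_continuous hk.
have [M M0 hM] : exists2 M : R, 0 <= M & forall d, D d -> `|d| <= M.
  have /compact_bounded [M [_ hM]] : compact D by exact: finite_compact.
  exists (Num.max 0 M + 1).
    by rewrite addr_ge0 // le_max lexx.
  by move=> d Dd; apply: hM => //; rewrite ltr_pwDr // le_max lexx orbT.
(* The radius C solves k * (C + M) = C, which makes the ball invariant. *)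
pose C := k * M / (1 - k).
have C0 : 0 <= C by rewrite !mulr_ge0 // invr_ge0 subr_ge0 ltW.
have CE : k * (C + M) <= C.
  have k1' : 1 - k != 0 by rewrite subr_eq0 gt_eqF.
  suff -> : k * (C + M) = C by [].
  apply: (mulIf k1'); rewrite -mulrA [(C + M) * _]mulrDl /C divfK //; ring.
pose B := [set x : V | `|x| <= C].
have FB K : K `<=` B -> hutchinson g D K `<=` B.
  move=> KB y [d Dd [x /KB /= Bx <-]] /=.
  apply: le_trans (hk _) _; apply: le_trans CE; apply: ler_wpM2l => //.
  by apply: le_trans (ler_normD _ _) _; apply: lerD => //; apply: hM.
pose T := [set x | exists K, [/\ K `<=` B, K `<=` hutchinson g D K & K x]].
have Tmax K : K `<=` B -> K `<=` hutchinson g D K -> K `<=` T.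
  by move=> KB KF x Kx; exists K.
have TB : T `<=` B by move=> x [K [KB _ Kx]]; exact: KB.
have TF : T `<=` hutchinson g D T.
  move=> x [K [KB KF Kx]]; have := KF _ Kx.
  by apply: hutchinsonS; exact: Tmax.
have Bc : compact B by exact: heine_borel.
have Bcl : closed B by apply: compact_closed => //; exact: norm_hausdorff.
have clTB : closure T `<=` B.
  by rewrite (closure_id B).1 //; exact: closureS.
have clTc : compact (closure T).
  by apply: subclosed_compact Bc clTB; exact: closed_closure.
have clT : closure T `<=` T.
  apply: Tmax => //.
  have Fcl : closed (hutchinson g D (closure T)).
    apply: compact_closed; first exact: norm_hausdorff.
    exact: compact_hutchinson.
  rewrite [X in _ `<=` X](closure_id _).1 //; apply: closureS.
  by apply: subset_trans TF _; apply: hutchinsonS; exact: subset_closure.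
exists T; split.
- exists 0; exists [set 0]; split=> //.
    by move=> x ->; rewrite /B /= normr0.
  by move=> x ->; exists 0 => //; exists 0 => //=; rewrite addr0 linear0.
- have -> : T = closure T by apply/seteqP; split=> //; exact: subset_closure.
  exact: clTc.
- apply/seteqP; split=> //; apply: Tmax; first exact: FB.
  exact: hutchinsonS.
Qed.

Lemma geometric_small (R : realType) (k : R) (k0 : 0 <= k) (k1 : k < 1)
    (C e : R) : 0 < e -> exists n, k ^+ n * C < e.
Proof.
move=> e0.
have : (fun n => k ^+ n * C) @ \oo --> (0 : R).
  rewrite -(mul0r C); apply: cvgMl.
  by apply: cvg_expr; rewrite ger0_norm.
move=> /cvgrPdist_lt /(_ e e0) [N _ /(_ N (leqnn N))].
rewrite sub0r normrN => h; exists N; exact: le_lt_trans (ler_norm _) h.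
Qed.

(** Bounded orbits of differences of digits start in T - T.  Following the orbit
    of x for n steps and pulling an arbitrary pair of points of T back along the
    same digits gives a pair of points of T whose difference is within k^n r of
    x; the set T - T is closed. *)
Lemma difference_in_attractor (R : realType) (V : normedModType R)
    (g : {linear V -> V}) (k : R) (k0 : 0 <= k) (k1 : k < 1)
    (hk : forall x, `|g x| <= k * `|x|) (D T S : set V) (r : R) :
  T !=set0 -> compact T -> T = hutchinson g D T ->
  (forall x, S x -> `|x| <= r) ->
  (forall x, S x -> exists u v y, [/\ D u, D v, S y & x = g (y + (u - v))]) ->
  forall x, S x -> exists t s, [/\ T t, T s & t = s + x].
Proof.
move=> [t0 Tt0] Tc TF Sr Sstep x Sx.
have Tg t d : T t -> D d -> T (g (t + d)).
  by move=> Tt Dd; rewrite TF; exists d => //; exists t.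
have approx n : forall x, S x ->
    exists t s, [/\ T t, T s & `|t - s - x| <= k ^+ n * r].
  elim: n => [|n IH] {Sx}x Sx.
    exists t0, t0; split=> //.
    by rewrite expr0 mul1r subrr sub0r normrN; exact: Sr.
  have [u [v [y [Du Dv Sy ->]]]] := Sstep _ Sx.
  have [t [s [Tt Ts hts]]] := IH _ Sy.
  exists (g (t + u)), (g (s + v)); split; [exact: Tg|exact: Tg|].
  rewrite -!linearB exprS -mulrA; apply: le_trans (hk _) _.
  apply: ler_wpM2l => //; apply: le_trans hts.
  rewrite [t + u - _](_ : _ = t - s + (u - v)); last by rewrite opprD addrACA.
  by rewrite opprD addrACA subrr addr0.
have Cc := compact_difference_set Tc Tc.
have Ccl : closed [set p.1 - p.2 | p in T `*` T].
  by apply: compact_closed => //; exact: norm_hausdorff.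
suff : [set p.1 - p.2 | p in T `*` T] x.
  by move=> [[t s] [/= Tt Ts] <-]; exists t, s; split=> //; rewrite addrC subrK.
apply: Ccl => U /nbhs_ballP [e /= e0 eU].
have [n hn] := geometric_small k0 k1 r e0.
have [t [s [Tt Ts hts]]] := approx n x Sx.
exists (t - s); split; first by exists (t, s).
apply: eU; rewrite -ball_normE /ball_ /= distrC.
exact: le_lt_trans hts hn.
Qed.

Lemma separation_gap (R : realType) (V : normedModType R) (A B : set V) :
  compact A -> compact B -> A `&` B = set0 ->
  exists2 e : R, 0 < e & forall x y, A x -> B y -> e <= `|x - y|.
Proof.
move=> Ac Bc AB0.
have : nbhs (0 : V) (~` [set p.1 - p.2 | p in A `*` B]).
  apply: open_nbhs_nbhs; split.
    apply: closed_openC; apply: compact_closed; first exact: norm_hausdorff.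
    exact: compact_difference_set.
  move=> [[x y] [/= Ax By]] /eqP; rewrite subr_eq0 => /eqP xy.
  suff : (A `&` B) x by rewrite AB0.
  by split=> //; rewrite xy.
move=> /nbhs_ballP [e /= e0 eU]; exists e => // x y Ax By.
rewrite leNgt; apply/negP => xye.
apply: (eU (x - y)); last by exists (x, y).
by rewrite -ball_normE /ball_ /= sub0r normrN.
Qed.

(** Suppose that membership in B is constant at distances below k^n C, with C
    larger than the diameter of T.  Then it is constant on T, by induction on n:
    the preimage of B under f_d has this property at the larger scale k^(n-1) C,
    so B is constant on each piece f_d(T), and pieces that meet share the value.
    By compactness a relatively clopen B has this property for some n. *)
Lemma attractor_connected (R : realType) (V : normedModType R)
    (g : {linear V -> V}) (k : R) (k0 : 0 < k) (k1 : k < 1)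
    (hk : forall x, `|g x| <= k * `|x|) (D T : set V) :
  compact T -> T = hutchinson g D T ->
  (forall P : set V,
     (forall d d' t t', D d -> D d' -> T t -> T t' -> t + d = t' + d' ->
        P d -> P d') ->
     forall d d', D d -> D d' -> P d -> P d') ->
  connected T.
Proof.
move=> Tc TF Dconn.
have Tg t d : T t -> D d -> T (g (t + d)).
  by move=> Tt Dd; rewrite TF; exists d => //; exists t.
have [C C0 hC] : exists2 C : R, 0 < C & forall x y, T x -> T y -> `|x - y| < C.
  have /compact_bounded [C [_ hC]] := compact_difference_set Tc Tc.
  exists (Num.max 0 C + 2).
    by rewrite ltr_wpDl // le_max lexx.
  move=> x y Tx Ty; apply: (@le_lt_trans _ _ (Num.max 0 C + 1)).
    apply: hC; last by exists (x, y).
    by rewrite ltr_pwDr // le_max lexx orbT.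
  by rewrite ltrD2l ltr1n.
have scale n : forall B : set V,
    (forall x y, T x -> T y -> `|x - y| < k ^+ n * C -> B x -> B y) ->
    forall x y, T x -> T y -> B x -> B y.
  elim: n => [|n IH] B hB x y Tx Ty.
    by apply: hB => //; rewrite expr0 mul1r; exact: hC.
  have const d : D d -> forall t s, T t -> T s -> B (g (t + d)) -> B (g (s + d)).
    move=> Dd; apply: (IH (fun t => B (g (t + d)))) => t s Tt Ts ts.
    apply: hB; [exact: Tg|exact: Tg|].
    rewrite -linearB opprD addrACA subrr addr0.
    rewrite exprS -mulrA; apply: le_lt_trans (hk _) _.
    by rewrite ltr_pM2l.
  move: Tx Ty; rewrite {1 2}TF => -[d Dd [t Tt <-]] [d' Dd' [s Ts <-]] Bt.
  pose P := [set d | forall z, T z -> B (g (z + d))].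
  suff : P d' by apply.
  apply: (Dconn P _ d d') => //; last by move=> z Tz; exact: const Bt.
  move=> {Bt s Ts d' Dd' t Tt d Dd x y} d d' t t' Dd Dd' Tt Tt' tt' Pd z Tz.
  by apply: (const d' Dd' t') => //; rewrite -tt'; exact: Pd.
move=> B [b Bb] [U Uo BU] [W Wc BW].
have Bc : compact B by rewrite BW; exact: compact_closedI.
have NBc : compact (T `&` ~` U) by apply: compact_closedI => //; exact: open_closedC.
have [|e e0 gap] := separation_gap Bc NBc.
  by apply/seteqP; split=> // x [+ [Tx nUx]]; rewrite BU => -[].
have [n hn] := geometric_small (ltW k0) k1 C e0.
have BT : B `<=` T by rewrite BU; exact: subIsetl.
apply/seteqP; split=> // x Tx.
apply: (scale n B _ b x (BT _ Bb) Tx Bb) => {Tx Bb} {}x y Tx Ty xy Bx.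
apply: contrapT => nBy.
suff /(gap x y Bx) : (T `&` ~` U) y by rewrite leNgt (lt_trans xy).
by split=> // Uy; apply: nBy; rewrite BU.
Qed.

(** * Column vectors with the sup norm *)

Lemma mx_norm_le (R : realType) (m n : nat) (x : 'M[R]_(m, n)) (c : R) :
  0 <= c -> (forall i j, `|x i j| <= c) -> `|x| <= c.
Proof.
move=> c0 xc; rewrite [leLHS]/Num.Def.normr /= mx_normrE.
by apply: bigmax_le => // -[i j] _; exact: xc.
Qed.

Lemma le_mx_norm (R : realType) (m n : nat) (x : 'M[R]_(m, n)) i j :
  `|x i j| <= `|x|.
Proof.
rewrite [leRHS]/Num.Def.normr /= mx_normrE.
by apply: (@le_bigmax _ _ _ 0 (fun ij => `|x ij.1 ij.2|) (i, j)).
Qed.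

Lemma mulmx_bounded (R : realType) (m n p : nat) (N : 'M[R]_(m, n))
    (x : 'M[R]_(n, p)) :
  `|N *m x| <= (n%:R * `|N|) * `|x|.
Proof.
apply: mx_norm_le => [|i j]; first by rewrite !mulr_ge0.
rewrite mxE; apply: le_trans (ler_norm_sum _ _ _) _.
apply: le_trans (_ : \sum_(k < n) `|N| * `|x| <= _).
  by apply: ler_sum => k _; rewrite normrM ler_pM // le_mx_norm.
by rewrite sumr_const card_ord -mulrA mulr_natl.
Qed.

Lemma mulmx_continuous (R : realType) (m n p : nat) (N : 'M[R]_(m, n)) :
  continuous (mulmx N : 'M[R]_(n, p) -> 'M[R]_(m, p)).
Proof. exact: (bounded_linear_map_continuous (mulmx_bounded N)). Qed.

Lemma cV_ball_compact (R : realType) (m : nat) (C : R) :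
  compact [set x : 'cV[R]_m | `|x| <= C].
Proof.
have trN n p (v : 'M[R]_(n, p)) : `|v^T| <= 1 * `|v|.
  by rewrite mul1r; apply: mx_norm_le => // i j; rewrite mxE le_mx_norm.
have trE n p (v : 'M[R]_(n, p)) : `|v^T| = `|v|.
  apply/le_anti; have := trN _ _ v; have := trN _ _ v^T.
  by rewrite !mul1r trmxK => -> ->.
have -> : [set x : 'cV[R]_m | `|x| <= C]
    = trmx @` [set v : 'rV[R]_m | `|v| <= C].
  apply/seteqP; split=> [x xC|x [v vC <-]] /=; last by rewrite trE.
  by exists x^T; rewrite ?trmxK //= trE.
apply: continuous_compact.
  apply: continuous_subspaceT.
  exact: (bounded_linear_map_continuous (trN 1%N m)).
apply: bounded_closed_compact.
  exists C; split; first exact: num_real.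
  by move=> M CM v /= vC; exact: le_trans vC (ltW CM).
apply: (@closed_comp _ _ (fun v : 'rV[R]_m => `|v|) [set x | x <= C]).
  by move=> v _; exact: norm_continuous.
exact: closed_le.
Qed.

(** * Triangular matrices with small off-diagonal part *)

Lemma trig_mulmxE (R : pzRingType) (m : nat) (M : 'M[R]_m) (y : 'cV[R]_m) i :
  is_trig_mx M ->
  (M *m y) i 0 = M i i * y i 0 + \sum_(j < m | (j < i)%N) M i j * y j 0.
Proof.
move=> /is_trig_mxP Mt.
rewrite mxE (bigD1 i) //=; congr (_ + _).
rewrite [RHS]big_mkcond [LHS]big_mkcond /=; apply: eq_bigr => j _.
rewrite -val_eqE /=; have [ij|ji|ij] := ltngtP i j => //=.
by rewrite Mt ?mul0r.
Qed.

(** Row i gives |y_i| <= (|x_i| + 1/2 max_(j < i) |y_j|) / 2 for x = M y, and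
    2/3 is the fixed point of c |-> (1 + c / 2) / 2. *)
Lemma trig_contraction (R : realType) (m : nat) (M : 'M[R]_m) :
  is_trig_mx M -> (forall i, 2 <= `|M i i|) ->
  (forall i : 'I_m, \sum_(j < m | (j < i)%N) `|M i j| <= 2^-1) ->
  forall y : 'cV[R]_m, `|y| <= 2 / 3 * `|M *m y|.
Proof.
move=> Mt M2 Moff y.
set X := `|M *m y|; have X0 : 0 <= 2 / 3 * X.
  by apply: mulr_ge0; [lra | exact: normr_ge0].
suff H k : forall i : 'I_m, (i < k)%N -> `|y i 0| <= 2 / 3 * X.
  apply: mx_norm_le => // i j.
  by rewrite [j]ord1; exact: (H m i).
elim: k => // k IH i; rewrite ltnS => ik.
have : `|(M *m y) i 0| <= X by exact: le_mx_norm.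
rewrite trig_mulmxE //.
set S := \sum_(_ < _ | _) _ => hX.
have hS : `|S| <= 2^-1 * (2 / 3 * X).
  apply: le_trans (ler_norm_sum _ _ _) _.
  apply: le_trans (_ : \sum_(j < m | (j < i)%N) `|M i j| * (2 / 3 * X) <= _).
    by apply: ler_sum => j ji; rewrite normrM ler_wpM2l // IH // (leq_trans ji ik).
  by rewrite -mulr_suml ler_wpM2r.
have hM : `|M i i * y i 0| <= X + 2^-1 * (2 / 3 * X).
  rewrite -[M i i * _](addrK S); apply: le_trans (ler_normB _ _) _.
  exact: lerD.
have : 2 * `|y i 0| <= `|M i i * y i 0| by rewrite normrM ler_wpM2r.
lra.
Qed.

(** A nearest integer to t has absolute value at most N, except when t is
    N + 1/2 itself and the tie has been broken upwards. *)
Lemma round_clamp (R : realType) (t : R) (N : int) :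
  `|t| <= N%:~R + 2^-1 -> exists2 d : int, `|d| <= N & `|t - d%:~R| <= 2^-1.
Proof.
rewrite ler_norml => /andP [tl tr].
pose d := Num.floor (t + 2^-1).
have d1 : d%:~R <= t + 2^-1 by exact: floor_le_tmp.
have d2 : t + 2^-1 < (d + 1)%:~R by exact: floorD1_gt.
have dl : - N <= d.
  by rewrite -ltzD1 -(ltr_int R) (le_lt_trans _ d2) // rmorphN /=; lra.
move: d2; rewrite rmorphD /= => d2.
have [dN|Nd] := lerP d N.
  by exists d; rewrite ?ler_norml ?dl //; apply/andP; split; lra.
have N0 : 0 <= N by rewrite -ltzD1 -(ltr_int R) rmorphD /=; lra.
move: Nd; rewrite -lezD1 -(ler_int R) rmorphD /= => Nd.
exists N; first by rewrite ger0_norm.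
by rewrite ler_norml; apply/andP; split; lra.
Qed.

Definition real_digits (R : realType) (m : nat) (L : 'M[int]_m) : set 'cV[R]_m :=
  [set map_mx intr n | n in [set n : 'cV[int]_m | digit_box L n]].

Lemma finite_real_digits (R : realType) (m : nat) (L : 'M[int]_m) :
  finite_set (@real_digits R m L).
Proof.
apply: finite_image; have [F hF] := digit_box_finite L id.
apply: (@sub_finite_set _ _ [set` F]); last exact: finite_fset.
by move=> n hn; apply/hF; exists n.
Qed.

(** The region in which the orbit of the i-th coordinate vector is kept. *)
Definition unit_step_set (R : realType) (m : nat) (i : 'I_m) : set 'cV[R]_m :=
  [set x | [/\ forall j : 'I_m, (j < i)%N -> x j 0 = 0, `|x i 0| = 1 &
     forall j : 'I_m, (i < j)%N -> `|x j 0| <= 2^-1]].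

(** The rows of the new vector are treated separately.  Rows above i vanish.  Row
    i of M x is L_ii or -L_ii, at distance 1 from an admissible difference of
    digits.  A row j below i has absolute value at most
    |L_jj| / 2 + 1/2 <= (|L_jj| - 1) + 1/2, hence is within 1/2 of an admissible
    one. *)
Lemma unit_step_orbit (R : realType) (m : nat) (L : 'M[int]_m)
    (M : 'M[R]_m) :
  is_trig_mx M -> (forall i, M i i = (L i i)%:~R) -> (forall i, 1 < `|L i i|) ->
  (forall i : 'I_m, \sum_(j < m | (j < i)%N) `|M i j| <= 2^-1) ->
  forall i x, unit_step_set i x -> exists u v y,
    [/\ real_digits L u, real_digits L v, unit_step_set i y &
        M *m x = y + (u - v)].
Proof.
move=> Mt Mdiag L1 Moff i x [xlo xi xhi].
have Mx j := trig_mulmxE x j Mt.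
have x1 j : `|x j 0| <= 1.
  have [ji|ij|/val_inj ->] := ltngtP j i; last by rewrite xi.
    by rewrite xlo // normr0.
  by apply: le_trans (xhi j ij) _; lra.
have Soff (j : 'I_m) : `|\sum_(k < m | (k < j)%N) M j k * x k 0| <= 2^-1.
  apply: le_trans (ler_norm_sum _ _ _) _; apply: le_trans (Moff j).
  by apply: ler_sum => k _; rewrite normrM ler_piMr.
have lo0 (j : 'I_m) : (j <= i)%N -> \sum_(k < m | (k < j)%N) M j k * x k 0 = 0.
  by move=> ji; rewrite big1 // => k kj; rewrite xlo ?mulr0 // (leq_trans kj ji).
have step (j : 'I_m) : exists d : int, `|d| < `|L j j| /\
    [/\ (j < i)%N -> (M *m x) j 0 - d%:~R = 0,
        j = i -> `|(M *m x) j 0 - d%:~R| = 1 &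
        (i < j)%N -> `|(M *m x) j 0 - d%:~R| <= 2^-1].
  rewrite Mx; have [ji|ij|/val_inj ji] := ltngtP j i.
  - exists 0; split; first by rewrite normr0 (lt_trans _ (L1 j)).
    split=> // [_|ij]; last by move: ji; rewrite ij ltnn.
    by rewrite xlo // lo0 ?(ltnW ji) // mulr0 addr0 subr0.
  - have [|d dN hd] := @round_clamp R
      (M j j * x j 0 + \sum_(k < m | (k < j)%N) M j k * x k 0) (`|L j j| - 1).
      apply: le_trans (ler_normD _ _) _; rewrite normrM Mdiag.
      have hL : 2 <= `|(L j j)%:~R : R|.
        by rewrite -intr_norm (ler_int R 2); have := L1 j; lia.
      have hx : `|(L j j)%:~R| * `|x j 0| <= `|(L j j)%:~R : R| * 2^-1.
        by rewrite ler_wpM2l // xhi.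
      by have := Soff j; rewrite rmorphB /= intr_norm; lra.
    exists d; split; first by lia.
    by split=> // e; move: ij; rewrite e ltnn.
  - subst j; rewrite lo0 // addr0 Mdiag.
    have [s s1 ->] : exists2 s : int, `|s| = 1 & x i 0 = s%:~R.
      have [/eqP|x0] := eqVneq (x i 0) 1; first by exists 1 => //; exact/eqP.
      exists (-1) => //; move: xi x0; case: ler0P => [_ h _|_ -> /eqP//].
      by rewrite -[x i 0]opprK h rmorphN rmorph1.
    have [t t1 tL] : exists2 t : int, `|t| = 1 & `|L i i - t| < `|L i i|.
      have := L1 i; have [L0|L0] := lerP 0 (L i i) => ?.
        by exists 1; lia.
      by exists (-1); lia.
    exists (s * (L i i - t)); rewrite normrM s1 mul1r; split=> //.
    split; rewrite ?ltnn // => _.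
    rewrite mulrC -rmorphM -rmorphB -intr_norm /= mulrBr opprB addrC subrK.
    by rewrite normrM s1 t1.
have [d hd] := choice step.
(* An integer d with |d| < |L_jj| is a difference of two digits: its positive
   and negative parts. *)
pose u := \col_j Num.max (d j) 0; pose v := \col_j Num.max (- d j) 0.
exists (map_mx intr u), (map_mx intr v),
  (M *m x - (map_mx intr u - map_mx intr v)).
split.
- exists u => // j; rewrite mxE; have [] := hd j; lia.
- exists v => // j; rewrite mxE; have [] := hd j; lia.
- have uv j : (map_mx intr u - map_mx intr v : 'cV[R]_m) j 0 = (d j)%:~R.
    by rewrite !mxE -rmorphB /=; congr (_%:~R); lia.
  have yE j : (M *m x - (map_mx intr u - map_mx intr v)) j 0
      = (M *m x) j 0 - (d j)%:~R.
    by rewrite -uv [LHS]mxE [X in _ + X]mxE.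
  split=> [j ji||j ij]; rewrite yE.
  + by have [_ [h _ _]] := hd j; exact: h.
  + by have [_ [_ h _]] := hd i; exact: h.
  + by have [_ [_ _ h]] := hd j; exact: h.
- by rewrite subrK.
Qed.

(** Every vector of the box descends to 0 by lowering a nonzero entry by 1, which
    stays inside the box. *)
Lemma box_connected (R : realType) (m : nat) (L : 'M[int]_m)
    (P : set 'cV[R]_m) :
  (forall (d d' : 'cV[R]_m) i, real_digits L d -> real_digits L d' ->
     d - d' = delta_mx i 0 -> P d <-> P d') ->
  forall d d', real_digits L d -> real_digits L d' -> P d -> P d'.
Proof.
move=> Pstep.
suff to0 k : forall n : 'cV[int]_m, digit_box L n ->
    (\sum_i `|n i 0%R| <= k)%N -> P (map_mx intr n) <-> P 0.
  move=> _ _ [n hn <-] [n' hn' <-] Pn.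
  by apply/(to0 _ n' hn' (leqnn _))/(to0 _ n hn (leqnn _)).
elim: k => [|k IH] n hn nk.
  suff -> : n = 0 by rewrite map_mx0.
  move: nk; rewrite leqn0 sum_nat_eq0 => /forallP n0.
  by apply/colP => i; rewrite mxE; have := n0 i; rewrite /= absz_eq0 => /eqP.
have [/forallP n0|] := boolP [forall i, n i 0 == 0].
  suff -> : n = 0 by rewrite map_mx0.
  by apply/colP => i; rewrite mxE; exact/eqP.
rewrite negb_forall => /existsP [i ni].
pose n' := n - delta_mx i 0.
have n'E j : n' j 0 = n j 0 - (j == i)%:R by rewrite !mxE eqxx andbT.
have hn' : digit_box L n'.
  move=> j; rewrite n'E; have := hn j; have [->|_] := eqVneq j i; last first.
    by rewrite subr0.
  by move: ni => /eqP; lia.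
apply: iff_trans (IH n' hn' _).
  apply: (Pstep _ _ i); [by exists n|by exists n'|].
  by rewrite -map_mxB /n' opprB addrC subrK map_delta_mx.
move: nk; rewrite (bigD1 i) //= [X in _ -> (X <= _)%N](bigD1 i) //= n'E eqxx.
rewrite (eq_bigr (fun j => `|n' j 0%R|%N)) => [|j ji].
  by have := hn i; move: ni => /eqP; set S := (\sum_(_ | _) _)%N; lia.
by rewrite n'E (negPf ji) subr0.
Qed.

Lemma trig_attractor_connected (R : realType) (m : nat) (L : 'M[int]_m)
    (M : 'M[R]_m) :
  is_trig_mx M -> (forall i, M i i = (L i i)%:~R) -> (forall i, 1 < `|L i i|) ->
  (forall i : 'I_m, \sum_(j < m | (j < i)%N) `|M i j| <= 2^-1) ->
  M \in unitmx /\
  exists T : set 'cV[R]_m, [/\ T !=set0, compact T,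
    T = hutchinson (mulmx (invmx M)) (real_digits L) T & connected T].
Proof.
move=> Mt Mdiag L1 Moff.
have Mu : M \in unitmx.
  rewrite unitmxE det_trig // unitfE; apply/prodf_neq0 => i _.
  by rewrite Mdiag intr_eq0; have := L1 i; apply: contraTneq => ->.
split=> //.
have M2 i : 2 <= `|M i i|.
  by rewrite Mdiag -intr_norm (ler_int R 2); have := L1 i; lia.
have hk (x : 'cV[R]_m) : `|invmx M *m x| <= 2 / 3 * `|x|.
  by have := trig_contraction Mt M2 Moff (invmx M *m x); rewrite mulKVmx.
have k0 : 0 < 2 / 3 :> R by lra.
have k1 : 2 / 3 < 1 :> R by lra.
have D0 : real_digits L (0 : 'cV[R]_m).
  exists 0; last by rewrite map_mx0.
  move=> i; rewrite mxE lexx /= normr_gt0.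
  by have := L1 i; apply: contraTneq => ->.
have [T [T0 Tc TF]] := attractor_exists (@cV_ball_compact R m) (ltW k0) k1 hk
  (finite_real_digits R L) D0.
exists T; split=> //.
apply: (attractor_connected k0 k1 hk Tc TF) => P Pstep.
have edge (i : 'I_m) : exists t s, [/\ T t, T s & t = s + delta_mx i 0].
  apply: (difference_in_attractor (S := @unit_step_set R m i) (r := 1)
    (ltW k0) k1 hk T0 Tc TF).
  - move=> x [xlo xi xhi]; apply: mx_norm_le => // j j'; rewrite [j']ord1.
    have [ji|ij|/val_inj ->] := ltngtP j i; last by rewrite xi.
      by rewrite xlo // normr0.
    by apply: le_trans (xhi j ij) _; lra.
  - move=> x Sx.
    have [u [v [y [Du Dv Sy Mx]]]] := unit_step_orbit Mt Mdiag L1 Moff Sx.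
    by exists u, v, y; split=> //; rewrite -Mx /= mulKmx.
  - split=> [j ji||j ij]; rewrite mxE ?eqxx ?normr1 //.
      by rewrite -val_eqE /= ltn_eqF.
    by rewrite -val_eqE /= gtn_eqF // normr0.
apply: box_connected => d d' i Dd Dd' dd'.
have [t [s [Tt Ts ts]]] := edge i.
have sd : s + d = t + d' by rewrite ts -dd' -addrA subrK.
by split; apply: Pstep; [exact: Dd|exact: Dd'|exact: Ts|exact: Tt| |
  exact: Dd'|exact: Dd|exact: Tt|exact: Ts|].
Qed.

(** * Transfer to the given matrix *)

(** If Q A = M Q, then Q^-1 maps an attractor of M for the digits Q D onto one of A
    for D. *)
Lemma attractor_similar (R : realType) (m : nat) (A : 'M[int]_m)
    (D : {fset 'cV[int]_m}) (M Q : 'M[R]_m) (DM T : set 'cV[R]_m) :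
  Q \in unitmx -> M \in unitmx -> Q *m map_mx intr A = M *m Q ->
  DM = [set Q *m map_mx intr d | d in [set` D]] ->
  [/\ T !=set0, compact T, T = hutchinson (mulmx (invmx M)) DM T & connected T] ->
  exists T : set 'cV[R]_m, is_attractor A D T /\ connected T.
Proof.
move=> Qu Mu QA DE [[t0 Tt0] Tc TF Tconn].
have Au : map_mx intr A \in @unitmx R m.
  have : Q *m map_mx intr A \in unitmx by rewrite QA unitmx_mul Mu.
  by rewrite unitmx_mul Qu.
have QV : invmx (map_mx intr A) *m invmx Q = invmx Q *m invmx M :> 'M[R]_m.
  apply: (can_inj (mulKmx Au)); rewrite mulKVmx //.
  apply: (can_inj (mulKmx Qu)); rewrite mulmxV // !mulmxA QA.
  by rewrite mulmxK // mulmxV.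
have step (d : 'cV[int]_m) (t : 'cV[R]_m) :
    ifs_map A d (invmx Q *m t)
      = invmx Q *m (invmx M *m (t + Q *m map_mx intr d)).
  rewrite /ifs_map mulmxA -QV -mulmxA.
  by congr (_ *m _); rewrite mulmxDr mulKmx.
have Qc : continuous (mulmx (invmx Q) : 'cV[R]_m -> 'cV[R]_m).
  exact: mulmx_continuous.
exists (mulmx (invmx Q) @` T); split; last first.
  by apply: connected_continuous_connected => //; exact: continuous_subspaceT.
split.
- by exists (invmx Q *m t0), t0.
- by apply: continuous_compact => //; exact: continuous_subspaceT.
- apply/seteqP; split=> [_ [t Tt <-]|_ [d Dd [_ [t Tt <-] <-]]].
    move: Tt; rewrite {1}TF DE => -[_ [d Dd <-] [t' Tt' <-]].
    by exists d => //; exists (invmx Q *m t'); [exists t' | rewrite step].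
  rewrite step; exists (invmx M *m (t + Q *m map_mx intr d)) => //.
  by rewrite TF DE; exists (Q *m map_mx intr d); [exists d | exists t].
Qed.

Theorem corollary3p3 (R : realType) (m : nat) (hm : (1 <= m)%N)
    (A : 'M[int]_m) (hA : is_dilation R A) (hq : rational_spectrum R A) :
  exists D : {fset 'cV[int]_m},
    is_digit_set A D /\
    exists T : set 'cV[R]_m, is_attractor A D T /\ connected T.
Proof.
have [P [L [Pu PA Lt L1]]] := rational_dilation_triangularization hA hq.
have L0 i : L i i != 0 by have := L1 i; apply: contraTneq => ->.
have [e [e0 eL eoff]] := scaling_exists L0.
have [D DE] := digit_box_finite L (fun n => invmx P *m (diag_mx e *m n)).
exists D; split; first exact: similar_digit_set Pu PA Lt L0 eL DE.
(* E M = L E: passing from L to M rescales the i-th coordinate by e_i. *)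
pose E : 'M[R]_m := map_mx intr (diag_mx e).
have er i : (e 0 i)%:~R != 0 :> R by rewrite intr_eq0 gt_eqF.
have Eu : E \in unitmx.
  rewrite unitmxE /E map_diag_mx det_diag unitfE; apply/prodf_neq0 => i _.
  by rewrite mxE er.
pose M : 'M[R]_m := \matrix_(i, j) ((L i j)%:~R * (e 0 j)%:~R / (e 0 i)%:~R).
have EM : E *m M = map_mx intr L *m E.
  apply/matrixP => i j; rewrite /E map_diag_mx mul_diag_mx mul_mx_diag !mxE.
  by rewrite mulrC divfK.
have Mt : is_trig_mx M.
  apply/is_trig_mxP => i j ij; rewrite mxE; move/is_trig_mxP: Lt => -> //.
  by rewrite !mul0r.
have Mdiag i : M i i = (L i i)%:~R by rewrite mxE mulfK.
have Moff (i : 'I_m) : \sum_(j < m | (j < i)%N) `|M i j| <= 2^-1.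
  have ei : 0 < (e 0 i)%:~R :> R by rewrite ltr0z.
  rewrite -(ler_pM2r ei) mulr_suml.
  have := eoff i; rewrite -(ler_int R) rmorphM rmorph_sum /=.
  rewrite [X in 2 * X <= _](_ : _
    = \sum_(j < m | (j < i)%N) `|M i j| * (e 0 i)%:~R).
    by lra.
  apply: eq_bigr => j _; rewrite mxE normf_div (gtr0_norm ei) divfK ?gt_eqF //.
  by rewrite normrM rmorphM /= intr_norm (@gtr0_norm _ (e 0 j)%:~R) // ltr0z.
have [Mu [T hT]] := trig_attractor_connected Mt Mdiag L1 Moff.
have PRu : map_mx intr P \in @unitmx R m.
  by rewrite unitmxE det_map_mx rmorph_unit -?unitmxE.
apply: (attractor_similar (Q := invmx E *m map_mx intr P) _ Mu _ _ hT).
- by rewrite unitmx_mul unitmx_inv Eu.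
- apply: (can_inj (mulKmx Eu)).
  by rewrite !mulmxA mulmxV // mul1mx EM mulmxK // -!map_mxM PA.
- have QE (n : 'cV[int]_m) :
      invmx E *m map_mx intr P *m map_mx intr (invmx P *m (diag_mx e *m n))
      = map_mx intr n.
    by rewrite -mulmxA -map_mxM mulKVmx // map_mxM mulKmx.
  apply/seteqP; split=> [_ [n hn <-]|_ [d /DE [n hn ->] <-]].
    by exists (invmx P *m (diag_mx e *m n)); [apply/DE; exists n | exact: QE].
  by rewrite QE; exists n.
Qed.
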